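(* Fix integers $n \geq 2$ and $k \geq 1$, and a unital commutative ring $R$. Let $u_i, v_j$ ($1 \leq i,j \leq n$) be odd (fermionic) variables over $R$ and let $t$ be an indeterminate. Then \[ \prod_{i,j=1}^n \left( \frac{1}{1 - t u_i v_j} \right)^k = \prod_{i,j=1}^n (1 + t u_i v_j)^k = 1 + k t\, (u_1 + \cdots + u_n)(v_1 + \cdots + v_n). \]
   Context: Odd (fermionic) variables: $u_1,\dots,u_n,v_1,\dots,v_n$ are the generators of the exterior algebra over $R$ of the free $R$-module with this basis. Thus they pairwise anticommute ($u_iu_j=-u_ju_i$, $v_iv_j=-v_jv_i$, $u_iv_j=-v_ju_i$) and $u_j^2=v_j^2=0$. The indeterminate $t$ commutes with everything. The elements $u_iv_j$ commute with one another, so the products are well-defined regardless of order; $\frac{1}{1-tu_iv_j}$ denotes the inverse of $1-tu_iv_j$, i.e. $\sum_{M\geq 0}(tu_iv_j)^M$. *)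

(* Defs.v *)
From HB Require Import structures.
From mathcomp Require Import all_boot all_order all_algebra.
From mathcomp Require Import ring boolp.

Set Implicit Arguments.
Unset Strict Implicit.
Unset Printing Implicit Defensive.
Import GRing.Theory.
Local Open Scope ring_scope.

(* [exterior R m] is the exterior algebra of the free R-module with basis
   e_0, ..., e_(m-1), in coordinates: x : exterior R m stands for
   \sum_A x A *: e_A, where e_A is the product of the e_i, i \in A, taken in
   increasing order of the indices (see [extE] and [prod_extgen]).
   It is an alias of a type of finite functions that keeps the module structure
   but not the pointwise product. *)
Definition exterior (R : comNzRingType) (m : nat) := {ffun {set 'I_m} -> R^o}.

HB.instance Definition _ (R : comNzRingType) (m : nat) :=
  GRing.Lmodule.on (exterior R m).

(* The number of transpositions needed to sort e_A e_B. *)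
Definition inversions (m : nat) (A B : {set 'I_m}) : nat :=
  #|[set p in setX A B | (p.2 < p.1)%N]|.

Section Product.
Variables (R : comNzRingType) (m : nat).
Implicit Types (i j : 'I_m) (x y z : exterior R m) (A B C S : {set 'I_m}).

Definition extmul x y : exterior R m :=
  [ffun S : {set 'I_m} =>
     (\sum_(A : {set 'I_m} | A \subset S)
        (-1) ^+ inversions A (S :\: A) * (x A : R) * (y (S :\: A) : R) : R^o)].

Definition extbase A : exterior R m :=
  [ffun S : {set 'I_m} => ((S == A)%:R : R^o)].

Definition extgen (i : 'I_m) : exterior R m := extbase [set i].

Lemma inversionsE A B :
  inversions A B = (\sum_(i in A) \sum_(j in B) (j < i)%N)%N.
Proof.
rewrite pair_big_dep /inversions -sum1dep_card big_mkcond /=.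
rewrite [RHS]big_mkcond /=; apply: eq_bigr => -[i j] _.
by rewrite !inE /=; case: (i \in A); case: (j \in B); case: (j < i)%N.
Qed.

Lemma inversions0l B : inversions set0 B = 0%N.
Proof. by rewrite inversionsE big_set0. Qed.

Lemma inversions0r A : inversions A set0 = 0%N.
Proof. by rewrite inversionsE big1 // => i _; rewrite big_set0. Qed.

Lemma inversionsUl A B C : [disjoint A & B] ->
  inversions (A :|: B) C = (inversions A C + inversions B C)%N.
Proof.
move=> dAB; rewrite !inversionsE -bigU //=.
by apply: eq_bigl => i; rewrite !inE.
Qed.

Lemma inversionsUr A B C : [disjoint B & C] ->
  inversions A (B :|: C) = (inversions A B + inversions A C)%N.
Proof.
move=> dBC; rewrite !inversionsE -big_split /=; apply: eq_bigr => i _.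
by rewrite -bigU //=; apply: eq_bigl => j; rewrite !inE.
Qed.

Lemma extmulA : associative extmul.
Proof.
move=> x y z; apply/ffunP => S; rewrite !ffunE.
under eq_bigr => A sAS do rewrite ffunE mulr_sumr.
under [RHS]eq_bigr => C sCS do rewrite ffunE mulr_sumr mulr_suml.
rewrite [RHS](exchange_big_dep (fun A => A \subset S)) /=; last first.
  by move=> C A sCS sAC; apply: subset_trans sCS.
apply: eq_bigr => A sAS.
rewrite [RHS](reindex_onto (fun B => A :|: B) (fun C => C :\: A)) /=; last first.
  move=> C /andP[_ sAC]; apply/setP => i; rewrite !inE.
  by case: (boolP (i \in A)) => //= iA; rewrite (subsetP sAC).
apply: eq_big => [B|B].
  rewrite subsetUl andbT subUset sAS /= subsetD; congr (_ && _).
  rewrite setDUl setDv set0U; apply/idP/eqP => [/disjoint_setI0 d|<-].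
    by apply/setDidPl; rewrite -setI_eq0 d.
  by rewrite -setI_eq0 setDE -setIA [~: A :&: A]setIC setICr setI0.
rewrite subsetD => /andP[sBS dBA].
have dAB : [disjoint A & B] by rewrite disjoint_sym.
have eB : (A :|: B) :\: A = B.
  by rewrite setDUl setDv set0U; apply/setDidPl.
rewrite eB -setDDl; set C := (S :\: A) :\: B.
have eBC : S :\: A = B :|: C.
  rewrite /C; apply/setP => i; rewrite !inE.
  case: (boolP (i \in B)) => //= iB.
  by rewrite (subsetP sBS) // (disjointFr dBA).
have dBC : [disjoint B & C].
  by rewrite -setI_eq0 /C setIC setDE -setIA [~: B :&: B]setIC setICr setI0.
rewrite {1}eBC inversionsUr // inversionsUl // !exprD.
set a := (-1) ^+ _; set b := (-1) ^+ _; set c := (-1) ^+ _.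
by move: (x A : R) (y B : R) (z C : R) => p q r; ring.
Qed.

Lemma extmul1l : left_id (extbase set0) extmul.
Proof.
move=> x; apply/ffunP => S; rewrite ffunE (bigD1 set0) ?sub0set //= big1.
  by rewrite ffunE eqxx inversions0l setD0 addr0 expr0 !mul1r.
by move=> A /andP[_ /negPf nA]; rewrite ffunE nA mulr0 mul0r.
Qed.

Lemma extmul1r : right_id (extbase set0) extmul.
Proof.
move=> x; apply/ffunP => S; rewrite ffunE (bigD1 S) //= big1.
  by rewrite ffunE setDv eqxx inversions0r addr0 expr0 mul1r mulr1.
move=> A /andP[sAS nAS]; rewrite ffunE (_ : (S :\: A == set0) = false).
  by rewrite mulr0.
by rewrite setD_eq0; apply: contraNF nAS => sSA; rewrite eqEsubset sAS.
Qed.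

Lemma extmulDl : left_distributive extmul +%R.
Proof.
move=> x y z; apply/ffunP => S; rewrite !ffunE -big_split /=.
by apply: eq_bigr => A _; rewrite !ffunE mulrDr mulrDl.
Qed.

Lemma extmulDr : right_distributive extmul +%R.
Proof.
move=> x y z; apply/ffunP => S; rewrite !ffunE -big_split /=.
by apply: eq_bigr => A _; rewrite !ffunE mulrDr.
Qed.

Lemma extbase0_neq0 : extbase set0 != 0.
Proof.
by apply/eqP => /ffunP /(_ set0); rewrite !ffunE eqxx => /eqP; rewrite oner_eq0.
Qed.

HB.instance Definition _ := GRing.Zmodule_isNzRing.Build (exterior R m)
  extmulA extmul1l extmul1r extmulDl extmulDr extbase0_neq0.

Lemma extscaleE (a : R) x S : (a *: x) S = a * (x S : R).
Proof. by rewrite ffunE. Qed.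

Lemma extscaleAl (a : R) x y : a *: (x * y) = (a *: x) * y.
Proof.
apply/ffunP => S; rewrite extscaleE !ffunE mulr_sumr.
by apply: eq_bigr => A _; rewrite extscaleE !mulrA (mulrC a).
Qed.

HB.instance Definition _ :=
  GRing.Lmodule_isLalgebra.Build R (exterior R m) extscaleAl.

Lemma extscaleAr (a : R) x y : a *: (x * y) = x * (a *: y).
Proof.
apply/ffunP => S; rewrite extscaleE !ffunE mulr_sumr.
by apply: eq_bigr => A _; rewrite extscaleE mulrCA.
Qed.

HB.instance Definition _ :=
  GRing.Lalgebra_isAlgebra.Build R (exterior R m) extscaleAr.

Lemma extbase_mul A B :
  extbase A * extbase B =
    if [disjoint A & B] then (-1) ^+ inversions A B *: extbase (A :|: B) else 0.
Proof.
apply/ffunP => S; rewrite ffunE (eq_bigr (fun A' : {set 'I_m} =>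
  if A' == A then (-1) ^+ inversions A B * (S :\: A == B)%:R else 0)); last first.
  move=> A' _; rewrite !ffunE; case: eqP => [->|_]; last by rewrite mulr0 mul0r.
  by rewrite mulr1; case: eqP => [->|_] //; rewrite !mulr0.
rewrite -big_mkcondr /=.
have [sAS|nsAS] := boolP (A \subset S); last first.
  rewrite big_pred0 => [|A']; last first.
    by apply/negP => /andP[sA /eqP eA]; rewrite -eA sA in nsAS.
  case: ifP => _; rewrite !ffunE // (_ : (S == A :|: B) = false) ?scaler0 //.
  by apply: contraNF nsAS => /eqP ->; rewrite subsetUl.
rewrite (big_pred1 A) => [|A']; last first.
  by rewrite /= andbC; case: eqP => //= ->.
have -> : (S :\: A == B) = [disjoint A & B] && (S == A :|: B).
  apply/eqP/andP => [<-|[dAB /eqP ->]].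
    split; first by rewrite -setI_eq0 setIDA setIC -setIDA setDv setI0.
    apply/eqP/setP => i; rewrite !inE.
    by case: (boolP (i \in A)) => //= iA; rewrite (subsetP sAS).
  by rewrite setDUl setDv set0U; apply/setDidPl; rewrite disjoint_sym.
by case: ifP => _; rewrite !ffunE //= mulr0.
Qed.

Lemma extgen_sqr i : extgen i * extgen i = 0.
Proof.
rewrite extbase_mul (_ : [disjoint _ & _] = false) //.
by rewrite disjoints1 inE eqxx.
Qed.

Lemma inversions11 (i j : 'I_m) : inversions [set i] [set j] = (j < i)%N.
Proof. by rewrite inversionsE !big_set1. Qed.

Lemma extgen_anticomm i j : extgen i * extgen j = - (extgen j * extgen i).
Proof.
have [->|nij] := eqVneq i j; first by rewrite extgen_sqr oppr0.
rewrite !extbase_mul !disjoints1 !inE (eq_sym j i) nij /= !inversions11 setUC.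
rewrite -scaleNr; congr (_ *: _).
by case: (ltngtP i j) (nij) => [||/val_inj->]; rewrite ?eqxx ?opprK.
Qed.

Lemma extE x : x = \sum_(A : {set 'I_m}) (x A : R) *: extbase A.
Proof.
apply/ffunP => S; rewrite sum_ffunE (bigD1 S) //= big1 => [|A nAS].
  by rewrite !ffunE eqxx addr0 /GRing.scale /= mulr1.
by rewrite !ffunE eq_sym (negPf nAS) scaler0.
Qed.

Lemma prod_extgen A : \prod_(i <- enum A) extgen i = extbase A.
Proof.
have lt_tr : transitive (fun i j : 'I_m => (i < j)%N).
  by move=> j i k; apply: ltn_trans.
have srt : sorted (fun i j : 'I_m => (i < j)%N) (enum A).
  rewrite {1}/enum_mem; apply: sorted_filter => //.
  rewrite -enumT; have := iota_ltn_sorted 0 m.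
  by rewrite -val_enum_ord sorted_map.
have -> : extbase A = extbase [set i in enum A].
  by congr extbase; apply/setP => i; rewrite inE mem_enum.
elim: (enum A) srt => [_|i s IHs] /=.
  by rewrite big_nil; congr extbase; apply/setP => i; rewrite !inE.
rewrite path_sortedE // => /andP[/allP lt_i srt].
rewrite big_cons IHs // extbase_mul disjoints1 inE.
case: ifPn => [_|]; last by rewrite negbK => /lt_i; rewrite ltnn.
rewrite inversionsE big_set1 big1 ?expr0 ?scale1r => [|j]; last first.
  by rewrite inE => /lt_i lt_ij; rewrite ltnNge ltnW.
by congr extbase; apply/setP => j; rewrite !inE.
Qed.

End Product.

(* The elements u_i v_j commute, which is why the order of the factors of the
   products over all (i, j) is immaterial. *)
Lemma extgen2_comm (R : comNzRingType) (m : nat) (a b c d : 'I_m) :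
  GRing.comm (extgen R a * extgen R b) (extgen R c * extgen R d).
Proof.
have anti := @extgen_anticomm R m.
rewrite /GRing.comm.
rewrite -[LHS]mulrA [X in _ * X = _](mulrA (extgen R b)) (anti b c) mulNr.
rewrite -[X in - X](mulrA (extgen R c)) (anti b d) !mulrN opprK.
rewrite (mulrA (extgen R a)) (anti a c) mulNr -[in LHS](mulrA (extgen R c)).
by rewrite (mulrA (extgen R a)) (anti a d) mulNr mulrN opprK !mulrA.
Qed.

Definition oddu (R : comNzRingType) (n : nat) (i : 'I_n) : exterior R (n + n) :=
  extgen R (lshift n i).

Definition oddv (R : comNzRingType) (n : nat) (j : 'I_n) : exterior R (n + n) :=
  extgen R (rshift n j).

Definition inverse_pair (A : nzRingType) (x y : A) : Prop :=
  x * y = 1 /\ y * x = 1.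

Definition invertible (A : nzRingType) (x : A) : Prop :=
  exists y, inverse_pair x y.

(* The library has no [unitRingType] structure on polynomials over a
   noncommutative ring.  As for [GRing.inv], the value at a noninvertible
   element is x itself. *)
Definition inverse (A : nzRingType) (x : A) : A :=
  if pselect (invertible x) is left ex then projT1 (cid ex) else x.

Lemma inverseP (A : nzRingType) (x : A) :
  invertible x -> inverse_pair x (inverse x).
Proof. by rewrite /inverse; case: pselect => // ex _; case: cid. Qed.

Lemma inverse_uniq (A : nzRingType) (x y : A) :
  inverse_pair x y -> inverse x = y.
Proof.
move=> [xy yx]; have [xi ix] : inverse_pair x (inverse x).
  by apply: inverseP; exists y.
by rewrite -[LHS]mul1r -yx -mulrA xi mulr1.
Qed.

(* Main.v *)
(* If x i * x j = 0 for all i, j (in particular x i ^+ 2 = 0), then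
   \prod_i (1 + x i) = 1 + \sum_i x i.  This applies three times: to k copies of
   t u_i v_j; to k t u_i v_j for a fixed i, as u_i^2 = 0; and finally to
   k t u_i (v_1 + ... + v_n), as (v_1 + ... + v_n)^2 = 0. *)
Require Import Defs.
From mathcomp Require Import all_boot all_order all_algebra.

Set Implicit Arguments.
Unset Strict Implicit.
Unset Printing Implicit Defensive.
Import GRing.Theory.
Local Open Scope ring_scope.

(** Induction on [r]: multiplying the new factor [1 + x i] into [1 + \sum_(j <- r) x j] leaves only
    cross terms [x i * x j], which vanish. *)
Lemma prod_1D_mul0 (A : pzRingType) (I : Type) (r : seq I) (x : I -> A) :
  (forall i j, x i * x j = 0) ->
  \prod_(i <- r) (1 + x i) = 1 + \sum_(i <- r) x i.
Proof.
move=> x0; elim: r => [|i r IHr]; first by rewrite !big_nil addr0.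
rewrite !big_cons IHr mulrDl mul1r mulrDr mulr1 mulr_sumr.
by rewrite [\sum_(j <- r) x i * _]big1 // addr0 addrAC addrA.
Qed.

Lemma exprD1_sqr0 (A : pzRingType) (x : A) (k : nat) :
  x * x = 0 -> (1 + x) ^+ k = 1 + x *+ k.
Proof.
move=> x0; have := @prod_1D_mul0 A _ (index_enum 'I_k) (fun=> x) (fun _ _ => x0).
by rewrite prodr_const sumr_const card_ord.
Qed.

(** The geometric series of [x] stops after its linear term. *)
Lemma inverse_1B_sqr0 (A : nzRingType) (x : A) :
  x * x = 0 -> inverse_pair (1 - x) (1 + x).
Proof.
move=> x0; split.
  by rewrite mulrDr mulr1 mulrBl mul1r x0 subr0 subrK.
by rewrite mulrBr mulr1 mulrDl mul1r x0 addr0 addrK.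
Qed.

(** Off-diagonal terms cancel in pairs. The squares need their own hypothesis: anticommutation only
    gives [x i * x i *+ 2 = 0], which is weaker in characteristic 2. *)
Lemma sqr_sum_anticomm (A : pzRingType) (I : Type) (r : seq I) (x : I -> A) :
  (forall i, x i * x i = 0) -> (forall i j, x i * x j = - (x j * x i)) ->
  (\sum_(i <- r) x i) * (\sum_(i <- r) x i) = 0.
Proof.
move=> x0 xN; elim: r => [|i r IHr]; first by rewrite big_nil mul0r.
rewrite big_cons mulrDl !mulrDr x0 IHr addr0 add0r mulr_sumr mulr_suml.
by rewrite -big_split big1 //= => j _; rewrite xN addNr.
Qed.

(** As ['X] is central, vanishing of such products reduces to the coefficient ring. *)
Lemma mulXC_mulXC (A : nzRingType) (a b c d : A) :
  ('X * a%:P * b%:P) * ('X * c%:P * d%:P) =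
  (a * b * (c * d))%:P * 'X * 'X :> {poly A}.
Proof.
rewrite -!(mulrA 'X) -!polyCM -!commr_polyX mulrA.
by rewrite -polyCM.
Qed.

Lemma oddvu (R : comNzRingType) (n : nat) (i j : 'I_n) :
  oddv R j * oddu R i = - (oddu R i * oddv R j).
Proof. exact: extgen_anticomm. Qed.

(** Swapping $v_j$ with the second $u_i$ produces the factor $u_i^2 = 0$. *)
Lemma oddu_same_mul0 (R : comNzRingType) (n : nat) (i j l : 'I_n) :
  oddu R i * oddv R j * (oddu R i * oddv R l) = 0.
Proof.
rewrite -mulrA [X in _ * X]mulrA oddvu mulNr mulrN -mulrA mulrA.
by rewrite extgen_sqr mul0r oppr0.
Qed.

(** Here $V$ anticommutes with $u_l$, so the product is $-u_i u_l V^2$. *)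
Lemma oddu_sum_oddv_mul0 (R : comNzRingType) (n : nat) (i l : 'I_n) :
  let V := \sum_(j < n) oddv R j in oddu R i * V * (oddu R l * V) = 0.
Proof.
move=> V; have VV : V * V = 0.
  by apply: sqr_sum_anticomm => [j|j m]; [apply: extgen_sqr|apply: extgen_anticomm].
have VuN : V * oddu R l = - (oddu R l * V).
  by rewrite mulr_suml mulr_sumr -sumrN; apply: eq_bigr => j _; apply: oddvu.
by rewrite -mulrA [X in _ * X]mulrA VuN mulNr -mulrA VV mulr0 oppr0 mulr0.
Qed.

Theorem proposition3p4 (n k : nat) (R : comNzRingType)
    (hn : (2 <= n)%N) (hk : (1 <= k)%N) :
  let t : {poly exterior R (n + n)} := 'X in
  let u (i : 'I_n) : {poly exterior R (n + n)} := (oddu R i)%:P in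
  let v (j : 'I_n) : {poly exterior R (n + n)} := (oddv R j)%:P in
  [/\ forall i j : 'I_n, invertible (1 - t * u i * v j),
      \prod_(i < n) \prod_(j < n) inverse (1 - t * u i * v j) ^+ k =
        \prod_(i < n) \prod_(j < n) (1 + t * u i * v j) ^+ k &
      \prod_(i < n) \prod_(j < n) (1 + t * u i * v j) ^+ k =
        1 + k%:R * t * (\sum_(i < n) u i) * (\sum_(j < n) v j)].
Proof.
move=> t u v.
have row0 i j l : t * u i * v j * (t * u i * v l) = 0.
  by rewrite mulXC_mulXC oddu_same_mul0 !mul0r.
(* The case $l = j$ of [row0] says that $t u_i v_j$ squares to zero. *)
have inv i j := inverse_1B_sqr0 (row0 i j j).
split=> [i j||]; first by exists (1 + t * u i * v j).
  by apply: eq_bigr => i _; apply: eq_bigr => j _; rewrite (inverse_uniq (inv i j)).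
set V := \sum_(j < n) v j.
have rowE i : \prod_(j < n) (1 + t * u i * v j) ^+ k = 1 + (t * u i * V) *+ k.
  under eq_bigr => j _ do rewrite exprD1_sqr0 //.
  rewrite prod_1D_mul0 => [|j l]; last by rewrite mulrnAl mulrnAr row0 !mul0rn.
  by rewrite sumrMnl -mulr_sumr.
under eq_bigr => i _ do rewrite rowE.
rewrite prod_1D_mul0 => [|i l]; last first.
  (* The sum of the constants $v_j$ is again a constant polynomial, so the reduction to coefficients
     applies. *)
  rewrite mulrnAl mulrnAr /V -rmorph_sum mulXC_mulXC oddu_sum_oddv_mul0.
  by rewrite !mul0r !mul0rn.
by rewrite sumrMnl -mulr_suml -mulr_sumr -!mulrA mulr_natl.
Qed.
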